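(* Let $m,n\ge2$, let $\mathbf{M}$ be an $m\times n$ interval matrix with the strong Monge property and $\underline{M}\ge0$, and let $\boldsymbol{\alpha}=[\underline{\alpha},\overline{\alpha}]$ with $0\le\underline{\alpha}\le\overline{\alpha}$ and $\alpha^C=\frac12(\underline\alpha+\overline\alpha)>0$, $\alpha^\Delta=\frac12(\overline\alpha-\underline\alpha)$. Assume $\underline{m}_{i,j+1}+\underline{m}_{i+1,j}+\overline{m}_{ij}+\overline{m}_{i+1,j+1}>0$ for all $1\le i<m$, $1\le j<n$. Then $\boldsymbol{\alpha}\mathbf{M}$ is a nonnegative interval matrix with the strong Monge property if and only if $$\frac{\alpha^\Delta}{\alpha^C}\le\phi,\qquad \phi=\min_{1\le i<m,\,1\le j<n}\frac{\underline{m}_{i,j+1}+\underline{m}_{i+1,j}-\overline{m}_{ij}-\overline{m}_{i+1,j+1}}{\underline{m}_{i,j+1}+\underline{m}_{i+1,j}+\overline{m}_{ij}+\overline{m}_{i+1,j+1}}.$$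
   Context: An interval matrix $\mathbf{M}=[\underline{M},\overline{M}]$ with real $m\times n$ matrices $\underline{M}\le\overline{M}$ is the set $\{A\in\mathbb{R}^{m\times n}:\underline{M}\le A\le\overline{M}\}$ (entrywise), with entries $\mathbf{m}_{ij}=[\underline{m}_{ij},\overline{m}_{ij}]$. For an interval $\boldsymbol\alpha$, $\boldsymbol\alpha\mathbf{M}$ is the interval matrix with entries $\boldsymbol\alpha\cdot\mathbf{m}_{ij}=\{a b: a\in\boldsymbol\alpha, b\in\mathbf{m}_{ij}\}$ (for nonnegative intervals this is $[\underline\alpha\,\underline m_{ij},\overline\alpha\,\overline m_{ij}]$). A real matrix $A$ is Monge if $a_{ij}+a_{k\ell}\le a_{i\ell}+a_{kj}$ for all $i<k$, $j<\ell$. An interval matrix has the strong Monge property if every real matrix it contains is Monge. *)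

(* Defs.v *)
From mathcomp Require Import all_boot all_order all_algebra.
From mathcomp Require Import classical_sets set_interval reals.

Set Implicit Arguments.
Unset Strict Implicit.
Unset Printing Implicit Defensive.

Import Order.TTheory GRing.Theory Num.Theory.

Local Open Scope classical_set_scope.
Local Open Scope ring_scope.

Definition lemx (R : realType) (m n : nat) (A B : 'M[R]_(m, n)) : Prop :=
  forall i j, A i j <= B i j.

(* An interval matrix is represented by the matrix of its entries, each entry
   being a subset of R; [setmx_members] recovers the set of real matrices. *)
Definition itvmx (R : realType) (m n : nat) (Lo Hi : 'M[R]_(m, n)) :
    'M[set R]_(m, n) :=
  \matrix_(i, j) `[Lo i j, Hi i j]%classic.

Definition setmx_members (R : realType) (m n : nat) (M : 'M[set R]_(m, n)) :
    set 'M[R]_(m, n) :=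
  [set A | forall i j, M i j (A i j)].

Definition setmul (R : realType) (X Y : set R) : set R :=
  [set a * b | a in X & b in Y].

Definition scale_setmx (R : realType) (m n : nat) (X : set R)
    (M : 'M[set R]_(m, n)) : 'M[set R]_(m, n) :=
  \matrix_(i, j) setmul X (M i j).

Definition nonneg_itvmx (R : realType) (m n : nat) (M : 'M[set R]_(m, n)) :
    Prop :=
  exists Lo Hi : 'M[R]_(m, n),
    [/\ lemx Lo Hi, lemx (const_mx 0) Lo & M = itvmx Lo Hi].

Definition monge (R : realType) (m n : nat) (A : 'M[R]_(m, n)) : Prop :=
  forall (i k : 'I_m) (j l : 'I_n), (i < k)%N -> (j < l)%N ->
    A i j + A k l <= A i l + A k j.

Definition strong_monge (R : realType) (m n : nat) (M : 'M[set R]_(m, n)) :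
    Prop :=
  forall A, setmx_members M A -> monge A.

Definition itv_center (R : realType) (lo hi : R) : R := 2^-1 * (lo + hi).
Definition itv_radius (R : realType) (lo hi : R) : R := 2^-1 * (hi - lo).

(* For i : 'I_p.+1, the consecutive positions i and i + 1 in 'I_p.+2. *)
Definition ord_cur (p : nat) (i : 'I_p.+1) : 'I_p.+2 :=
  widen_ord (leqnSn p.+1) i.
Definition ord_next (p : nat) (i : 'I_p.+1) : 'I_p.+2 := lift ord0 i.

Definition antidiag_lo (R : realType) (m n : nat) (Lo : 'M[R]_(m.+2, n.+2))
    (i : 'I_m.+1) (j : 'I_n.+1) : R :=
  Lo (ord_cur i) (ord_next j) + Lo (ord_next i) (ord_cur j).

Definition diag_hi (R : realType) (m n : nat) (Hi : 'M[R]_(m.+2, n.+2))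
    (i : 'I_m.+1) (j : 'I_n.+1) : R :=
  Hi (ord_cur i) (ord_cur j) + Hi (ord_next i) (ord_next j).

Definition monge_ratio (R : realType) (m n : nat) (Lo Hi : 'M[R]_(m.+2, n.+2))
    (i : 'I_m.+1) (j : 'I_n.+1) : R :=
  (antidiag_lo Lo i j - diag_hi Hi i j) / (antidiag_lo Lo i j + diag_hi Hi i j).

(* The seed of the iterated minimum is one of the minimized values, so this is
   exactly the minimum of the ratios. *)
Definition monge_phi (R : realType) (m n : nat) (Lo Hi : 'M[R]_(m.+2, n.+2)) :
    R :=
  \big[Num.min/monge_ratio Lo Hi ord0 ord0]_(ij : 'I_m.+1 * 'I_n.+1)
    monge_ratio Lo Hi ij.1 ij.2.

(* Main.v *)
(** The product of two nonnegative intervals is the interval of the extreme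
    products, so [alpha M] is always a nonnegative interval matrix and only the
    strong Monge property matters. A real matrix is Monge as soon as its
    consecutive 2 x 2 minors satisfy the Monge inequality (telescoping), and the
    worst case for such a minor takes the upper bounds on its diagonal and the
    lower bounds on its antidiagonal. Hence [alpha M] is strongly Monge iff
    [ahi * d <= alo * a] for every consecutive minor, with [d] the sum of the
    upper diagonal and [a] of the lower antidiagonal entries; since [a + d > 0]
    and [alo + ahi > 0], this is
    [(ahi - alo) / (ahi + alo) <= (a - d) / (a + d)]. *)
Require Import Defs.
From mathcomp Require Import all_boot all_order all_algebra.
From mathcomp Require Import classical_sets set_interval reals.
From mathcomp Require Import ring lra.
Import Order.TTheory GRing.Theory Num.Theory.
Local Open Scope classical_set_scope.
Local Open Scope ring_scope.

(** Every value in between is reached along two edges of the rectangle of factors: from [(a, c)] to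
    [(b, c)] the product sweeps [[a * c, b * c]], then up to [(b, d)] it sweeps [[b * c, b * d]]. *)
Lemma setmul_itvcc (R : realType) (a b c d : R) :
  0 <= a -> a <= b -> 0 < b -> 0 <= c -> c <= d ->
  setmul `[a, b]%classic `[c, d]%classic = `[a * c, b * d]%classic.
Proof.
move=> a0 ab b0 c0 cd; apply/seteqP; split=> y /=.
  move=> [x /=]; rewrite in_itv /= => /andP[ax xb].
  move=> [z /=]; rewrite in_itv /= => /andP[cz zd] <-.
  have x0 := le_trans a0 ax; have z0 := le_trans c0 cz.
  by rewrite in_itv /= !ler_pM.
rewrite in_itv /= => /andP[acy ybd].
have [ybc|bcy] := leP y (b * c).
  have [c_gt0|c_le0] := ltP 0 c.
    exists (y / c); first by rewrite /= in_itv /= ler_pdivlMr// ler_pdivrMr// acy.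
    by exists c; [rewrite /= in_itv /= lexx | rewrite divfK// gt_eqF].
  (* The first edge collapses: its only product is 0, so any first factor will do. *)
  have c_eq0 : c = 0 by apply/le_anti; rewrite c_le0.
  exists a; first by rewrite /= in_itv /= lexx.
  exists c; first by rewrite /= in_itv /= lexx.
  by apply/le_anti; rewrite acy; move: ybc; rewrite c_eq0 !mulr0.
exists b; first by rewrite /= in_itv /= lexx andbT.
exists (y / b); last by rewrite mulrC divfK// gt_eqF.
by rewrite /= in_itv /= ler_pdivlMr// ler_pdivrMr// ![_ * b]mulrC ybd ltW.
Qed.

Lemma nonneg_scale_itvmx {R : realType} {m n : nat} (Lo Hi : 'M[R]_(m, n))
    (a b : R) : lemx Lo Hi -> lemx (const_mx 0) Lo ->
  0 <= a -> a <= b -> 0 < b ->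
  nonneg_itvmx (scale_setmx `[a, b]%classic (itvmx Lo Hi)).
Proof.
move=> LoHi Lo0 a0 ab b0.
have Lo_ge0 i j : 0 <= Lo i j by have := Lo0 i j; rewrite mxE.
exists (a *: Lo), (b *: Hi); split=> [i j|i j|].
- by rewrite !mxE ler_pM.
- by rewrite !mxE mulr_ge0.
- by apply/matrixP => i j; rewrite !mxE setmul_itvcc.
Qed.

Lemma nonincreasing_upto {R : numDomainType} {p : nat} (g : nat -> R) :
  (forall i, (i < p)%N -> g i.+1 <= g i) ->
  forall i k, (i <= k <= p)%N -> g k <= g i.
Proof.
move=> gS i; elim=> [|k IHk]; first by rewrite leqn0 => /andP[/eqP->].
case/andP; rewrite leq_eqVlt => /orP[/eqP-> //|ik kp].
by apply: le_trans (gS k kp) (IHk _); rewrite -[(i <= k)%N]ltnS ik ltnW.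
Qed.

Lemma monge_consecutive {R : realType} {m n : nat} (A : 'M[R]_(m.+2, n.+2)) :
  (forall (i : 'I_m.+1) (j : 'I_n.+1),
     A (ord_cur i) (ord_cur j) + A (ord_next i) (ord_next j) <=
     A (ord_cur i) (ord_next j) + A (ord_next i) (ord_cur j)) ->
  monge A.
Proof.
move=> adjA i k j l ik jl.
(* Natural-number indices allow induction by successor; [inord] is faithful because every index used
   stays in range. *)
pose f (r c : nat) := A (inord r) (inord c).
(* Read this way, the consecutive inequality says that the difference of rows [r.+1] and [r] does
   not increase from column [c] to [c.+1]. *)
have fS r c : (r < m.+1)%N -> (c < n.+1)%N ->
    f r.+1 c.+1 - f r c.+1 <= f r.+1 c - f r c.
  move=> rm cn; have := adjA (Ordinal rm) (Ordinal cn).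
  have -> : ord_cur (Ordinal rm) = inord r.
    by apply: val_inj; rewrite /= inordK// ltnW.
  have -> : ord_cur (Ordinal cn) = inord c.
    by apply: val_inj; rewrite /= inordK// ltnW.
  have -> : ord_next (Ordinal rm) = inord r.+1.
    by apply: val_inj; rewrite /= inordK.
  have -> : ord_next (Ordinal cn) = inord c.+1.
    by apply: val_inj; rewrite /= inordK.
  rewrite -/(f r c) -/(f r.+1 c) -/(f r c.+1) -/(f r.+1 c.+1); lra.
(* Chaining over the columns from [j] to [l] and regrouping makes the difference of columns [l] and
   [j] nonincreasing in the row, ready for a second chaining from [i] to [k]. *)
have rowS r : (r < m.+1)%N -> f r.+1 l - f r.+1 j <= f r l - f r j.
  move=> rm; have jln : (j <= l <= n.+1)%N by rewrite (ltnW jl) -ltnS ltn_ord.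
  have := nonincreasing_upto (fun c => f r.+1 c - f r c) (fun c => fS r c rm)
    j l jln.
  rewrite /=; lra.
have ikm : (i <= k <= m.+1)%N by rewrite (ltnW ik) -ltnS ltn_ord.
have := nonincreasing_upto (fun r => f r l - f r j) rowS i k ikm.
rewrite /f !inord_val; lra.
Qed.

Lemma strong_monge_scale_itvmx {R : realType} {m n : nat}
    (Lo Hi : 'M[R]_(m.+2, n.+2)) (a b : R) :
  lemx Lo Hi -> lemx (const_mx 0) Lo -> 0 <= a -> a <= b -> 0 < b ->
  strong_monge (scale_setmx `[a, b]%classic (itvmx Lo Hi)) <->
  forall i j, b * diag_hi Hi i j <= a * antidiag_lo Lo i j.
Proof.
move=> LoHi Lo0 a0 ab b0.
have Lo_ge0 r c : 0 <= Lo r c by have := Lo0 r c; rewrite mxE.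
have scaleE r c : (scale_setmx `[a, b]%classic (itvmx Lo Hi)) r c =
    `[a * Lo r c, b * Hi r c]%classic by rewrite !mxE setmul_itvcc.
have le_ends r c : a * Lo r c <= b * Hi r c by rewrite ler_pM.
split=> [sM i j|minors A AM].
  (* The worst member for the minor at [(i, j)]: there the two tests agree exactly on the diagonal.
     Elsewhere either endpoint is admissible. *)
  pose A : 'M[R]_(m.+2, n.+2) := \matrix_(r, c)
    if (r == ord_cur i) == (c == ord_cur j) then b * Hi r c else a * Lo r c.
  have AM : setmx_members (scale_setmx `[a, b]%classic (itvmx Lo Hi)) A.
    move=> r c; rewrite scaleE /= in_itv /= mxE.
    by case: ifP => _; rewrite lexx le_ends.
  have neq p (h : 'I_p.+1) : (ord_next h == ord_cur h) = false.
    by apply/negbTE; rewrite -val_eqE /= /bump /= add1n gtn_eqF.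
  have lt_next p (h : 'I_p.+1) : (ord_cur h < ord_next h)%N.
    by rewrite /= /bump add1n.
  have := sM A AM _ _ _ _ (lt_next _ i) (lt_next _ j).
  by rewrite !mxE !neq !eqxx /= -!mulrDr.
apply: monge_consecutive => i j.
have bounds r c : a * Lo r c <= A r c <= b * Hi r c.
  by have := AM r c; rewrite scaleE /= in_itv.
have := minors i j; rewrite /diag_hi /antidiag_lo !mulrDr.
have /andP[_ ] := bounds (ord_cur i) (ord_cur j).
have /andP[_ ] := bounds (ord_next i) (ord_next j).
have /andP[+ _] := bounds (ord_cur i) (ord_next j).
have /andP[+ _] := bounds (ord_next i) (ord_cur j).
lra.
Qed.

Lemma le_monge_phi {R : realType} {m n : nat} (Lo Hi : 'M[R]_(m.+2, n.+2))
    (x : R) :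
  x <= monge_phi Lo Hi <-> forall i j, x <= monge_ratio Lo Hi i j.
Proof.
split=> [xphi i j|xratio].
  apply: le_trans xphi _.
  exact: (bigmin_le_cond _ (fun ij => monge_ratio Lo Hi ij.1 ij.2)
    (erefl : xpredT (i, j))).
by apply: le_bigmin => // ij _.
Qed.

Lemma radius_center_le_ratio {R : realType} (a b u d : R) :
  0 < itv_center a b -> 0 < u + d ->
  (itv_radius a b / itv_center a b <= (u - d) / (u + d)) = (b * d <= a * u).
Proof.
move=> ab0 ud0.
rewrite ler_pdivrMr// mulrAC ler_pdivlMr// /itv_radius /itv_center.
(* With denominators cleared, both inequalities have the same difference of sides,
   [a * u - b * d]. *)
by rewrite -subr_ge0 -[RHS]subr_ge0; congr (0 <= _); field.
Qed.

Theorem theorem5p1 (R : realType) (m n : nat)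
    (Mlo Mhi : 'M[R]_(m.+2, n.+2)) (alo ahi : R)
    (hM : lemx Mlo Mhi)
    (hMonge : strong_monge (itvmx Mlo Mhi))
    (hM0 : lemx (const_mx 0) Mlo)
    (ha0 : 0 <= alo) (ha : alo <= ahi)
    (haC : 0 < itv_center alo ahi)
    (hpos : forall (i : 'I_m.+1) (j : 'I_n.+1),
        0 < antidiag_lo Mlo i j + diag_hi Mhi i j) :
  (nonneg_itvmx (scale_setmx `[alo, ahi]%classic (itvmx Mlo Mhi)) /\
   strong_monge (scale_setmx `[alo, ahi]%classic (itvmx Mlo Mhi)))
  <->
  itv_radius alo ahi / itv_center alo ahi <= monge_phi Mlo Mhi.
Proof.
(* The upper end is at least the midpoint, so it is positive and can serve as a divisor in
   [setmul_itvcc]. *)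
have ahi0 : 0 < ahi by move: haC; rewrite /itv_center; lra.
have smE := strong_monge_scale_itvmx Mlo Mhi alo ahi hM hM0 ha0 ha ahi0.
split=> [[_ /smE minors]|/le_monge_phi ratios].
  by apply/le_monge_phi => i j; rewrite radius_center_le_ratio.
split; first exact: nonneg_scale_itvmx.
apply/smE => i j; rewrite -(radius_center_le_ratio _ _ _ _ haC (hpos i j)).
exact: ratios.
Qed.
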